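(* Let $X,Y,W$, $j$, $\eta$ and $(\psi_\gamma)_{\gamma>0}$ satisfy properties (P1)--(P9) listed in the context. Then, for $\gamma>0$, the optimization problem $$\min_{v\in X\cap Y}\; j(v)+\psi_\gamma(v)+\eta(v)$$ admits a solution.
   Context: Properties: (P1) $X$ is a Hilbert space, $W$ is a separable Banach space, and the embedding $X\hookrightarrow W$ is compact. (P2) $Y$ is the dual of a separable Banach space (weak$^\ast$ convergence in $Y$ refers to this predual). (P3) The embedding $Y\hookrightarrow W$ is continuous. (P4) For each sequence $(v^k)_{k\in\mathbb N}\subset X\cap Y$ that converges weakly to $\hat v$ in $X$ and weakly$^\ast$ to $\bar v$ in $Y$, it holds that $\hat v=\bar v$ in $X\cap Y$. (P5) For each $\gamma>0$, $\psi_\gamma:Y\to\mathbb R\cup\{\infty\}$ is weakly$^\ast$ sequentially lower semicontinuous. (P6) $\eta:X\to\mathbb R$ is weakly lower semicontinuous. (P7) $j:Y\to\mathbb R$ is continuous w.r.t. the $W$-topology: if $(v^k)_{k\in\mathbb N}\subset Y$, $v\in Y$ and $v^k\to v$ strongly in $W$, then $j(v^k)\to j(v)$. (P8) The functions $j$, $\psi_\gamma$ ($\gamma>0$) and $\eta$ are bounded from below on $X\cap Y$. (P9) Boundedness of $(\psi_\gamma(v^k)+\eta(v^k))_{k\in\mathbb N}$ (for a sequence $(v^k)_{k\in\mathbb N}\subset X\cap Y$) implies boundedness of $(\|v^k\|_Y+\|v^k\|_X)_{k\in\mathbb N}$. *)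

(* Defs.v *)
From HB Require Import structures.
From mathcomp Require Import all_boot all_order all_algebra.
From mathcomp Require Import all_classical all_reals all_analysis.

Set Implicit Arguments.
Unset Strict Implicit.
Unset Printing Implicit Defensive.

Import Order.TTheory GRing.Theory Num.Theory.
Import numFieldNormedType.Exports.

Local Open Scope classical_set_scope.
Local Open Scope ring_scope.

Definition separable_space (T : topologicalType) : Prop :=
  exists2 D : set T, countable D & dense D.

(* Completeness is carried by the type; [{dot X for idfun}] is the type of real
   inner products (symmetric positive definite bilinear forms). *)
Definition is_hilbert (R : realType) (X : completeNormedModType R) : Prop :=
  exists dot : {dot X for idfun}, forall x : X, dot x x = `|x| ^+ 2.

Definition is_embedding (R : realType) (U V : normedModType R)
    (i : {linear U -> V}) : Prop :=
  injective i /\ continuous i.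

Definition compact_map (R : realType) (U V : normedModType R)
    (i : U -> V) : Prop :=
  forall B : set U, bounded_set B -> precompact (i @` B).

(* [Y] is the dual of [Z]: [T] is an isometric isomorphism from [Y] onto the
   space of continuous linear functionals on [Z] with the operator norm. *)
Definition is_dual_pairing (R : realType) (Y Z : completeNormedModType R)
    (T : Y -> {linear Z -> R^o}) : Prop :=
  [/\ forall y, continuous (T y),
      forall (a : R) (y1 y2 : Y) (z : Z),
        T (a *: y1 + y2) z = a * T y1 z + T y2 z,
      forall y, `|y| = sup [set `|T y z| | z in [set z : Z | `|z| <= 1]]
    & forall f : {linear Z -> R^o}, continuous f -> exists y, T y =1 f].

Definition weak_cvg (R : realType) (X : normedModType R) (u : nat -> X) (x : X)
    : Prop :=
  forall f : {linear X -> R^o}, continuous f -> f (u k) @[k --> \oo] --> f x.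

Definition weak_star_cvg (R : realType) (Y Z : completeNormedModType R)
    (T : Y -> {linear Z -> R^o}) (u : nat -> Y) (y : Y) : Prop :=
  forall z : Z, T (u k) z @[k --> \oo] --> T y z.

(* A copy of [X] carrying the coarsest topology for which every norm-continuous
   linear functional is continuous. *)
Definition weak_space (R : realType) (X : normedModType R) : topologicalType :=
  sup_topology (fun f : {f : {linear X -> R^o} | continuous f} =>
    Topological.on (initial_topology (sval f))).

Lemma weak_cvgE (R : realType) (X : normedModType R) (u : nat -> X) (x : X) :
  weak_cvg u x <-> u @ \oo --> (x : weak_space X).
Proof.
rewrite cvg_sup; split => [ux [f cf] A /= | ux f cf A fxA].
  have /= -> := @nbhsE (initial_topology f) x.
  case=> B [] [C oC <-] Cfx CA.
  apply: filterS CA _; apply: (ux f cf); exact: open_nbhs_nbhs.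
apply: (ux (exist _ f cf) (f @^-1` A)).
have /= -> := @nbhsE (initial_topology f) x.
move: fxA; rewrite nbhsE => - [C [oC Cfx] CA].
by exists (f @^-1` C) => [|z /CA //]; split=> //; exists C.
Qed.

(* The intersection of [X] and [Y], which are identified with subspaces of [W]: a pair
   [(x, y)] with the same image in [W] is one element of the intersection. *)
Definition XcapY (R : realType) (X Y W : completeNormedModType R)
    (iX : {linear X -> W}) (iY : {linear Y -> W}) : set (X * Y) :=
  [set v | iX v.1 = iY v.2].

Definition bounded_below_on (R : realType) (T : Type) (A : set T)
    (f : T -> \bar R) : Prop :=
  exists m : R, forall v, A v -> (m%:E <= f v)%E.

(* For values in [R] or [+oo] this forces every term to be finite. *)
Definition bounded_eseq (R : realType) (a : nat -> \bar R) : Prop :=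
  exists M : R, forall k, (`|a k| <= M%:E)%E.

Definition bounded_seq (R : realType) (a : nat -> R) : Prop :=
  exists M : R, forall k, `|a k| <= M.

(* Main.v *)
Require Import Defs.
From HB Require Import structures.
From mathcomp Require Import all_boot all_order all_algebra.
From mathcomp Require Import all_classical all_reals all_analysis.
From mathcomp Require Import ring lra.

Set Implicit Arguments.
Unset Strict Implicit.
Unset Printing Implicit Defensive.

Import Order.TTheory GRing.Theory Num.Theory.
Import numFieldNormedType.Exports.

Local Open Scope classical_set_scope.
Local Open Scope ring_scope.

(* The direct method: a minimizing sequence is bounded in X and Y by (P8), (P9),
   so along a subsequence it converges weakly* in Y (Banach-Alaoglu with a
   separable predual) and strongly in W (compactness of the embedding of X).
   A bounded sequence of the Hilbert space X whose images under the injective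
   embedding converge in W converges weakly in X: any closed convex set
   containing it meets the fibre over the limit, since nested closed convex sets
   with points of bounded norm have a common point.  (P4) identifies the two
   limits, and lower semicontinuity of the objective concludes. *)

(** * Hilbert space geometry and weak convergence *)

Lemma hilbert_parallelogram (R : realType) (X : completeNormedModType R) :
  is_hilbert X -> forall x y : X,
  `|x + y| ^+ 2 + `|x - y| ^+ 2 = 2 * `|x| ^+ 2 + 2 * `|y| ^+ 2.
Proof.
case=> dot dotE x y; rewrite -!dotE linearDl linearBl !linearDr !linearNr.
by ring.
Qed.

(* Almost norm-minimal points of [E n] form a Cauchy sequence, by the
   parallelogram identity. *)
Lemma hilbert_nested_closed_meet (R : realType) (X : completeNormedModType R)
    (E : nat -> set X) (M : R) :
  is_hilbert X ->
  (forall n, closed (E n)) ->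
  (forall n x y, E n x -> E n y -> E n (2^-1 *: (x + y))) ->
  (forall n m, (n <= m)%N -> E m `<=` E n) ->
  (forall n, exists2 x, E n x & `|x| <= M) ->
  exists x, forall n, E n x.
Proof.
move=> hX cE midE nE bE.
pose S n := [set `|x| ^+ 2 | x in E n].
have S_lb n : has_inf (S n).
  split; first by have [x Ex _] := bE n; exists (`|x| ^+ 2); exists x.
  by exists 0 => _ [x _ <-]; exact: sqr_ge0.
pose d n := inf (S n).
have le_d n x : E n x -> d n <= `|x| ^+ 2.
  by move=> Ex; apply: ge_inf; [exact: (S_lb n).2|exists x].
have d_sup : has_sup (range d).
  split; first by exists (d 0%N); exists 0%N.
  exists (M ^+ 2) => _ [n _ <-]; have [x Ex xM] := bE n.
  by apply: le_trans (le_d _ _ Ex) _; rewrite lerXn2r ?nnegrE // (le_trans _ xM).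
have near_min n : {x | E n x & `|x| ^+ 2 < d n + n.+1%:R^-1}.
  apply: cid2; have eps0 : 0 < n.+1%:R^-1 :> R by rewrite invr_gt0 ltr0n.
  by have [_ [x Ex <-] xd] := inf_adherent eps0 (S_lb n); exists x.
pose e n := s2val (near_min n).
have Ee n : E n (e n) by exact: s2valP (near_min n).
have ed n : `|e n| ^+ 2 < d n + n.+1%:R^-1 by exact: s2valP' (near_min n).
have e_cvg : cvgn e.
  apply/cauchy_cvgP/cauchy_exP => r r0.
  (* The slack [r ^+ 2 / 16] occurs three times: in the two squared norms and between [d N1] and the
     supremum. By the parallelogram identity the squared distance is then below [r ^+ 2 / 2]. *)
  have eps0 : 0 < r ^+ 2 / 16 by rewrite divr_gt0 ?exprn_gt0.
  have [_ [N1 _ <-] dN1] := sup_adherent eps0 d_sup.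
  have [N2 _ N2P] : \forall n \near \oo, n.+1%:R^-1 < r ^+ 2 / 16 :> R.
    have := near_infty_natSinv_lt (PosNum eps0); apply: filterS => n /=; exact.
  pose N := maxn N1 N2.
  have up n : (N <= n)%N -> `|e n| ^+ 2 < sup (range d) + r ^+ 2 / 16.
    move=> Nn; apply: lt_trans (ed n) _; apply: ler_ltD.
      by apply: sup_upper_bound => //; exists n.
    by apply: N2P => /=; rewrite (leq_trans _ Nn) ?leq_maxr.
  exists (e N); exists N => // n /= Nn; rewrite -ball_normE /=.
  have EN1 m : (N <= m)%N -> E N1 (e m).
    by move=> Nm; apply: (nE _ m) => //; rewrite (leq_trans _ Nm) ?leq_maxl.
  have := le_d _ _ (midE _ _ _ (EN1 _ (leqnn _)) (EN1 _ Nn)).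
  rewrite normrZ exprMn gtr0_norm ?invr_gt0 // => mid.
  have := hilbert_parallelogram hX (e N) (e n).
  have := up _ (leqnn _); have := up _ Nn => u1 u2 par.
  rewrite -(ltr_pXn2r (ltn0Sn 1)) ?nnegrE ?normr_ge0 ?(ltW r0) //.
  set a := `|e N| ^+ 2 in u1 u2 par *; set b := `|e n| ^+ 2 in u1 u2 par *.
  set c := `|e N + e n| ^+ 2 in mid par *; set f := `|_ - _| ^+ 2 in par *.
  by lra.
exists (lim (e @ \oo)) => n.
apply: (closed_cvg (E n) (cE n) _ _ e_cvg).
by exists n => // m /= nm; exact: nE nm _ (Ee m).
Qed.

(* The almost-fibres [E n] of [i] over [w] inside [D] are closed, convex and
   nested; this replaces a weak compactness argument in [X]. *)
Lemma hilbert_bounded_fiber (R : realType) (X W : completeNormedModType R)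
    (i : {linear X -> W}) (D : set X) (y : nat -> X) (w : W) (M : R) :
  is_hilbert X -> continuous i -> closed D ->
  (forall a b, D a -> D b -> D (2^-1 *: (a + b))) ->
  (forall k, D (y k)) -> (forall k, `|y k| <= M) ->
  i (y k) @[k --> \oo] --> w ->
  exists2 x, D x & i x = w.
Proof.
move=> hX ci cD midD Dy yM iyw.
pose E n := D `&` [set x | `|i x - w| <= n.+1%:R^-1].
have [n|n a b [Da aE] [Db bE]|n m nm x [Dx xE]|n|x Ex] :=
    @hilbert_nested_closed_meet R X E M hX.
- apply: closedI => //.
  have -> : [set x | `|i x - w| <= n.+1%:R^-1] =
      (fun x => `|i x - w|) @^-1` [set r | r <= n.+1%:R^-1] by [].
  apply: closed_comp; last exact: closed_le.
  move=> x _; apply: cvg_norm; apply: cvgB; [exact: ci|exact: cvg_cst].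
- split; first exact: midD.
  rewrite /= linearZ linearD.
  have -> : 2^-1 *: (i a + i b) - w = 2^-1 *: ((i a - w) + (i b - w)).
    rewrite [in RHS]addrACA [RHS]scalerDr -opprD scalerN -mulr2n.
    by rewrite -[w *+ 2]scaler_nat scalerA mulVf ?scale1r.
  rewrite normrZ gtr0_norm ?invr_gt0 // mulrC ler_pdivrMr //.
  apply: le_trans (ler_normD _ _) _.
  by rewrite mulr_natr mulr2n lerD.
- split=> //; apply: le_trans xE _.
  by rewrite lef_pV2 ?posrE ?ltr0n // ler_nat ltnS.
- have n0 : 0 < n.+1%:R^-1 :> R by rewrite invr_gt0 ltr0n.
  move/cvgrPdist_le : iyw => /(_ _ n0) [k _ /(_ k (leqnn _)) /= kn].
  by exists (y k) => //; split=> //=; rewrite distrC.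
exists x; first exact: (Ex 0%N).1.
apply/eqP; rewrite -subr_eq0 -normr_le0; apply/ler_addgt0Pl => e e0.
rewrite addr0; have [n _ /(_ n (leqnn _)) /= ne] := near_infty_natSinv_lt (PosNum e0).
by apply: le_trans (Ex n).2 _; exact: ltW.
Qed.

(** If [f (y k)] stayed at least [e] away from [f x] on one side along a subsequence, these [y k]
    would lie in a closed half-space. The fibre of [i] over [i x] would meet it, but by injectivity
    this fibre is only [x], which lies outside. *)
Lemma hilbert_bounded_weak_cvg (R : realType) (X W : completeNormedModType R)
    (i : {linear X -> W}) (y : nat -> X) (x : X) (M : R) :
  is_hilbert X -> is_embedding i ->
  (forall k, `|y k| <= M) -> i (y k) @[k --> \oo] --> i x ->
  weak_cvg y x.
Proof.
move=> hX [inji ci] yM iyx f cf.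
(* [s] is a sign: the values 1 and -1 give the upper and the lower bound. *)
have side (s e : R) : 0 < e -> \forall k \near \oo, s * (f (y k) - f x) < e.
  move=> e0; apply: contrapT => nfar.
  have far n : {k | (n <= k)%N & e <= s * (f (y k) - f x)}.
    apply: cid2; apply: contrapT => nk; apply: nfar; exists n => // k /= nk'.
    by rewrite ltNge; apply/negP => ek; apply: nk; exists k.
  pose t n := s2val (far n).
  have tn n : (n <= t n)%N by exact: s2valP (far n).
  pose D := [set z | e <= s * (f z - f x)].
  have [|a b Da Db|k|k||z] :=
      @hilbert_bounded_fiber R X W i D (y \o t) (i x) M hX ci.
  - have -> : D = (fun z => s * (f z - f x)) @^-1` [set r | e <= r] by [].
    apply: closed_comp; last exact: closed_ge.
    move=> z _; apply: cvgMr; apply: cvgB; [exact: cf|exact: cvg_cst].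
  - rewrite /D /= in Da Db *; rewrite linearZ linearD /= /GRing.scale /=.
    by lra.
  - exact: s2valP' (far k).
  - exact: yM.
  - apply: (@cvg_comp _ _ _ t (i \o y) _ _ _ _ iyx).
    by move=> A [n _ nA]; exists n => // k /= nk; apply: nA; exact: leq_trans (tn k).
  by move=> /[swap] /inji ->; rewrite /D /= subrr mulr0 leNgt e0.
apply/cvgrPdist_lt => e e0; near=> k.
rewrite ltr_norml; apply/andP; split.
  have : 1 * (f (y k) - f x) < e by near: k; exact: side.
  by lra.
have : -1 * (f (y k) - f x) < e by near: k; exact: side.
by lra.
Unshelve. all: by end_near. Qed.

(** * Ultrafilters and extraction of subsequences *)

Lemma ultra_fmap (S T : Type) (u : S -> T) (U : set_system S) :
  UltraFilter U -> UltraFilter (u @ U).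
Proof.
move=> UU; split=> [|G GG uUG]; first exact: fmap_proper_filter.
rewrite eqEsubset; split=> // A GA.
have [//|UnA] := in_ultra_setVsetC (u @^-1` A) UU.
by have /filter_ex [? []] : G (A `&` ~` A) by apply: filterI => //; exact: uUG.
Qed.

Lemma compact_ultra_cvg (S : Type) (T : topologicalType) (K : set T)
    (u : S -> T) (U : set_system S) :
  UltraFilter U -> compact K -> (forall k, K (u k)) ->
  exists2 p, K p & u @ U --> p.
Proof.
rewrite compact_ultra => UU cK uK.
have [|p [Kp up]] := cK (u @ U) (ultra_fmap u UU); last by exists p.
exact: (@filterE _ U _ (u @^-1` K)).
Qed.

(** Members of an ultrafilter finer than [\oo] meet every tail. The indices need not increase:
    [n <= s n] already makes [s] tend to infinity. *)
Lemma ultra_oo_subseq (U : set_system nat) (A : nat -> set nat) :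
  UltraFilter U -> \oo `<=` U -> (forall n, U (A n)) ->
  exists2 s : nat -> nat, forall n, (n <= s n)%N & forall n, A n (s n).
Proof.
move=> UU ooU UA.
suff /choice [s sP] : forall n, exists k, (n <= k)%N /\ A n k.
  by exists s => n; have [] := sP n.
move=> n; have : U ([set k | (n <= k)%N] `&` A n).
  by apply: filterI => //; apply: ooU; exists n.
by move=> /filter_ex [k [nk Ank]]; exists k.
Qed.

Lemma cvg_subseq_oo (s : nat -> nat) :
  (forall n, (n <= s n)%N) -> s n @[n --> \oo] --> \oo.
Proof.
move=> ns A [n _ nA]; exists n => // k /= nk; apply: nA.
exact: leq_trans (ns k).
Qed.

Lemma compact_map_subseq (R : realType) (U V : normedModType R)
    (i : U -> V) (u : nat -> U) (M : R) :
  compact_map i -> (forall k, `|u k| <= M) ->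
  exists2 s : nat -> nat, forall n, (n <= s n)%N &
    exists w : V, i (u (s n)) @[n --> \oo] --> w.
Proof.
move=> ci uM.
have /ci : bounded_set (range u).
  exists M; split; first exact: num_real.
  by move=> r Mr _ [k _ <-]; exact: le_trans (uM k) (ltW Mr).
rewrite precompactE => cpt.
have [G [UG ooG]] := ultraFilterLemma eventually_filter.
have [|w _ iuw] := @compact_ultra_cvg _ _ _ (i \o u) G UG cpt.
  by move=> k; apply: subset_closure; exists (u k) => //; exists k.
(* Choosing the index from shrinking balls around [w] turns the limit along [G] into a limit of a
   sequence. *)
have [|s ns sw] := @ultra_oo_subseq G
    (fun n => [set k | `|w - i (u k)| < n.+1%:R^-1]) UG ooG.
  move=> n; move/cvgrPdist_lt : iuw; apply.
  by rewrite invr_gt0 ltr0n.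
exists s => //; exists w; apply/cvgrPdist_lt => e e0.
have := near_infty_natSinv_lt (PosNum e0); apply: filterS => n /=.
exact: lt_trans (sw n).
Qed.

(** * Dual pairing and sequential weak* compactness *)

Lemma dual_pairing_le (R : realType) (Y Z : completeNormedModType R)
    (T : Y -> {linear Z -> R^o}) (y : Y) (z : Z) :
  is_dual_pairing T -> `|T y z| <= `|y| * `|z|.
Proof.
move=> [cT _ Tn _].
have [->|z0] := eqVneq z 0; first by rewrite linear0 !normr0 mulr0.
have nz0 : 0 < `|z| by rewrite normr_gt0.
(* A [sup] bounds the members of its set only if the set is bounded above; continuity of [T y]
   supplies this. *)
have /linear_boundedP [r [_ rP]] : bounded_near (T y) (nbhs 0).
  exact/linear_bounded_continuous/cT.
have bT x : `|x| <= 1 -> `|T y x| <= `|r| + 1.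
  move=> x1; apply: le_trans (rP (`|r| + 1) _ x) _.
    by rewrite (le_lt_trans (ler_norm r)) ?ltrDl.
  by rewrite ler_piMr ?addr_ge0.
rewrite -ler_pdivrMr // Tn.
apply: sup_upper_bound.
  split; first by exists `|T y 0|; exists 0; rewrite //= normr0.
  by exists (`|r| + 1) => _ [x x1 <-]; exact: bT.
exists (`|z|^-1 *: z).
  by rewrite /= normrZ normfV normr_id mulVf ?gt_eqF.
by rewrite linearZ normrZ normfV normr_id mulrC.
Qed.

Lemma dual_pairing_represent (R : realType) (Y Z : completeNormedModType R)
    (T : Y -> {linear Z -> R^o}) (phi : Z -> R^o) (M : R) :
  is_dual_pairing T -> linear phi -> (forall z, `|phi z| <= M * `|z|) ->
  exists y, T y =1 phi.
Proof.
move=> [_ _ _ repr] lphi bphi.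
pose L := GRing.isLinear.Build R Z R^o *:%R phi lphi.
pose f : {linear Z -> R^o} := HB.pack phi L.
have [|y Ty] := repr f; last by exists y.
apply/linear_bounded_continuous/linear_boundedP.
exists M; split; first exact: num_real.
move=> r Mr z; apply: le_trans (bphi z) _.
by rewrite ler_wpM2r // ltW.
Qed.

(* The weak* limit is taken along an ultrafilter; separability of the predual
   then allows a sequence to be extracted. *)
Lemma banach_alaoglu_seq (R : realType) (Y Z : completeNormedModType R)
    (T : Y -> {linear Z -> R^o}) (u : nat -> Y) (M : R) :
  is_dual_pairing T -> separable_space Z -> (forall k, `|u k| <= M) ->
  exists2 s : nat -> nat, forall n, (n <= s n)%N &
    exists y, weak_star_cvg T (u \o s) y.
Proof.
move=> dT [D cD dD] uM.
have M0 : 0 <= M by exact: le_trans (uM 0%N).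
have Tu k z : `|T (u k) z| <= M * `|z|.
  by apply: le_trans (dual_pairing_le _ _ dT) _; rewrite ler_wpM2r.
have [G [UG ooG]] := ultraFilterLemma eventually_filter.
(* The values at each [z] stay in a compact segment, so they converge along the same [G] for all [z]
   at once. *)
have /choice [phi phiP] z : exists l : R^o, T (u k) z @[k --> G] --> l.
  have [|l _] := compact_ultra_cvg (u := fun k => T (u k) z) UG
    (@segment_compact R (- (M * `|z|)) (M * `|z|)); last by exists l.
  by move=> k; rewrite /= in_itv /= -ler_norml.
have lphi : linear phi.
  move=> a z1 z2; apply: (cvg_unique _ (phiP _)) => //=.
  under eq_cvg do rewrite linearP.
  by apply: cvgD => //; apply: cvgZr.
have bphi z : `|phi z| <= M * `|z|.
  have cn : `|T (u k) z| @[k --> G] --> `|phi z| by exact: cvg_norm.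
  apply: (closed_cvg [set r | r <= M * `|z|] _ _ _ cn); first exact: closed_le.
  by apply: (@filterE _ G) => k; exact: Tu.
have [y Ty] := dual_pairing_represent dT lphi bphi.
have [g gD] : exists g : nat -> Z, forall z, D z -> exists n, g n = z.
  move/countable_injP : cD => [h hD].
  (* An inverse of the injection [h] of [D] into [nat], with default [0] off its image, so a finite
     or empty [D] needs no separate case. *)
  exists (fun n => xget 0 [set z | D z /\ h z = n]) => z Dz; exists (h z).
  case: xgetP => [x _ [Dx hx]|/(_ z) []] //.
  by apply: hD => //; exact: mem_set.
(* The index [s n] is accurate at the first [n.+1] points of the enumeration simultaneously, so one
   sequence serves every point of [D]. *)
have [|s ns sP] := @ultra_oo_subseq G
    (fun n => [set k | forall m : 'I_n.+1,
      `|T y (g m) - T (u k) (g m)| < n.+1%:R^-1]) UG ooG.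
  move=> n; apply: filter_forall => m.
  move/cvgrPdist_lt : (phiP (g m)) => /(_ n.+1%:R^-1); rewrite -Ty; apply.
  by rewrite invr_gt0 ltr0n.
exists s => //; exists y => z; apply/cvgrPdist_lt => e e0.
(* Three errors of at most [e / 4] are planned: two for replacing [z] by a point of [D], one at that
   point. [M + 1] keeps the denominator positive when [M] is zero. *)
have d0 : 0 < e / (4 * (M + 1)) by rewrite divr_gt0 // mulr_gt0 // ltr_wpDl.
have [x [zx Dx]] : ball z (e / (4 * (M + 1))) `&` D !=set0.
  by apply: dD; [exists z; exact: ballxx|exact: ball_open].
have [m gm] := gD _ Dx.
move: zx; rewrite -ball_normE /= => zx.
have zxM : M * `|z - x| <= e / 4.
  apply: (@le_trans _ _ ((M + 1) * (e / (4 * (M + 1))))).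
    by apply: ler_pM => //; [rewrite lerDl|exact: ltW].
  by rewrite invfM mulrCA [X in _ * X]mulrCA mulfV ?mulr1 // gt_eqF // ltr_wpDl.
have e2 : 0 < e / 4 by rewrite divr_gt0.
near=> n.
have mn : (m < n.+1)%N by rewrite ltnS; near: n; exact: nbhs_infty_ge.
have := sP n (Ordinal mn); rewrite /= gm => Tx.
have n4 : n.+1%:R^-1 < e / 4.
  by near: n; exact: (near_infty_natSinv_lt (PosNum e2)).
have -> : T y z - T (u (s n)) z =
    T y (z - x) + (T y x - T (u (s n)) x) - T (u (s n)) (z - x).
  by rewrite !linearB /=; ring.
apply: le_lt_trans (ler_normB _ _) _.
have le_e : e / 4 + e / 4 + e / 4 < e by lra.
apply: le_lt_trans le_e; apply: lerD; last exact: le_trans (Tu _ _) zxM.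
apply: le_trans (ler_normD _ _) _; apply: lerD; last exact/ltW/(lt_trans Tx).
by rewrite Ty; exact: le_trans (bphi _) zxM.
Unshelve. all: by end_near. Qed.

(** * Lower limits and existence of a minimizer *)

(** The lower limit is the supremum of the tail infima, so [b] lies below one of them and hence
    below that whole tail. *)
Lemma lt_limn_einf (R : realType) (u : nat -> \bar R) (b : \bar R) :
  (b < limn_einf u)%E -> \forall k \near \oo, (b < u k)%E.
Proof.
rewrite limn_einf_lim (cvg_lim _ (@cvg_einfs_sup _ _)) //.
move=> /ereal_sup_gt [_ [n _ <-] bn]; exists n => // k /= nk.
by apply: lt_le_trans bn _; apply: ereal_inf_lbound; exists k.
Qed.

Theorem lemma2p3 (R : realType) (X Y W Z : completeNormedModType R)
    (iX : {linear X -> W}) (iY : {linear Y -> W})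
    (T : Y -> {linear Z -> R^o})
    (j : Y -> R) (psi : R -> Y -> \bar R) (eta : X -> R)
    (P1_hilbert : is_hilbert X)
    (P1_separable : separable_space W)
    (P1_embedding : is_embedding iX)
    (P1_compact : compact_map iX)
    (P2_separable : separable_space Z)
    (P2_dual : is_dual_pairing T)
    (P3 : is_embedding iY)
    (P4 : forall (v : nat -> X * Y) (vhat : X) (vbar : Y),
      (forall k, XcapY iX iY (v k)) ->
      weak_cvg (fun k => (v k).1) vhat ->
      weak_star_cvg T (fun k => (v k).2) vbar ->
      XcapY iX iY (vhat, vbar))
    (P5_range : forall (gamma : R) (y : Y), 0 < gamma -> (-oo < psi gamma y)%E)
    (P5 : forall gamma : R, 0 < gamma -> forall (v : nat -> Y) (y : Y),
      weak_star_cvg T v y ->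
      (psi gamma y <= limn_einf (fun k => psi gamma (v k)))%E)
    (P6 : lower_semicontinuous (fun x : weak_space X => (eta x)%:E))
    (P7 : forall (v : nat -> Y) (y : Y),
      iY (v k) @[k --> \oo] --> iY y -> j (v k) @[k --> \oo] --> j y)
    (P8_j : bounded_below_on (XcapY iX iY) (fun v => (j v.2)%:E))
    (P8_psi : forall gamma : R, 0 < gamma ->
      bounded_below_on (XcapY iX iY) (fun v => psi gamma v.2))
    (P8_eta : bounded_below_on (XcapY iX iY) (fun v => (eta v.1)%:E))
    (P9 : forall gamma : R, 0 < gamma -> forall v : nat -> X * Y,
      (forall k, XcapY iX iY (v k)) ->
      bounded_eseq (fun k => psi gamma (v k).2 + (eta (v k).1)%:E)%E ->
      bounded_seq (fun k => `|(v k).2| + `|(v k).1|)) :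
  forall gamma : R, 0 < gamma ->
    exists2 v : X * Y, XcapY iX iY v &
      forall u : X * Y, XcapY iX iY u ->
        ((j v.2)%:E + psi gamma v.2 + (eta v.1)%:E <=
         (j u.2)%:E + psi gamma u.2 + (eta u.1)%:E)%E.
Proof.
move=> gamma gamma0; set A := XcapY iX iY.
have [mj mjP] := P8_j; have [mp mpP] := P8_psi _ gamma0; have [me meP] := P8_eta.
(* The objective as a real number; [fine] sends [+oo] to [0], so [g] represents it only where [psi]
   is finite. *)
pose g (v : X * Y) := j v.2 + fine (psi gamma v.2) + eta v.1.
have gE v : (psi gamma v.2 < +oo)%E ->
    ((j v.2)%:E + psi gamma v.2 + (eta v.1)%:E = (g v)%:E)%E.
  move=> fv; rewrite -(@fineK _ (psi gamma v.2)) //.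
  by rewrite fin_numElt P5_range ?fv.
have infE v : ~ (psi gamma v.2 < +oo)%E ->
    ((j v.2)%:E + psi gamma v.2 + (eta v.1)%:E = +oo)%E.
  by move=> /negP; rewrite ltey negbK => /eqP ->.
pose S := [set g v | v in [set v | A v /\ (psi gamma v.2 < +oo)%E]].
have A0 : A (0, 0) by rewrite /A /XcapY /= !linear0.
(* If [S] is empty, the objective is [+oo] on all of [A] and [(0, 0)] is a minimizer. *)
have [S0|/set0P/negP/negPn/eqP S0] := pselect (S !=set0); last first.
  exists (0, 0) => // u Au; rewrite [leRHS]infE ?leey // => fu.
  by have : S (g u) by [exists u]; rewrite S0.
have g_ge v : A v -> (psi gamma v.2 < +oo)%E -> mp <= fine (psi gamma v.2).
  move=> Av fv; rewrite -lee_fin fineK ?mpP //.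
  by rewrite fin_numElt P5_range ?fv.
have S_inf : has_inf S.
  split=> //; exists (mj + mp + me) => _ [v [Av fv] <-].
  apply: lerD; [apply: lerD|]; last by have := meP _ Av; rewrite lee_fin.
    by have := mjP _ Av; rewrite lee_fin.
  exact: g_ge.
have /choice [v vP] n : exists v, [/\ A v, (psi gamma v.2 < +oo)%E &
    g v < inf S + n.+1%:R^-1].
  have e0 : 0 < n.+1%:R^-1 :> R by rewrite invr_gt0 ltr0n.
  by have [_ [v [Av fv] <-] gv] := inf_adherent e0 S_inf; exists v.
have Av n : A (v n) by have [] := vP n.
have fv n : (psi gamma (v n).2 < +oo)%E by have [] := vP n.
have gv n : g (v n) < inf S + n.+1%:R^-1 by have [] := vP n.
have [M vM] : bounded_seq (fun k => `|(v k).2| + `|(v k).1|).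
  apply: (P9 _ gamma0) => //.
  (* Along the sequence [psi + eta] lies between [mp + me] and [inf S + 1 - mj]. *)
  exists (`|mp + me| + `|inf S + 1 - mj|) => k.
  rewrite -(@fineK _ (psi gamma (v k).2)) ?fin_numElt ?P5_range //=.
  rewrite lee_fin ler_norml.
  have := g_ge _ (Av k) (fv k); have := meP _ (Av k); have := mjP _ (Av k).
  have : g (v k) < inf S + 1.
    by apply: lt_le_trans (gv k) _; rewrite lerD2l invf_le1 ?ler1n ?ltr0n.
  rewrite !lee_fin /g.
  have := ler_norm (inf S + 1 - mj); have := ler_norm (- (mp + me)).
  have := normr_ge0 (inf S + 1 - mj); have := normr_ge0 (mp + me).
  rewrite normrN => *; apply/andP; split; lra.
have vM1 k : `|(v k).1| <= M.
  by apply: le_trans (vM k); rewrite ger0_norm ?addr_ge0 // lerDr.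
have vM2 k : `|(v k).2| <= M.
  by apply: le_trans (vM k); rewrite ger0_norm ?addr_ge0 // lerDl.
have [s1 ns1 [w s1w]] :=
  compact_map_subseq (u := fun k => (v k).1) P1_compact vM1.
have [s2 ns2 [y s2y]] := banach_alaoglu_seq (u := fun k => (v (s1 k)).2)
  P2_dual P2_separable (fun k => vM2 (s1 k)).
pose s := s1 \o s2.
have ns n : (n <= s n)%N by exact: leq_trans (ns2 n) (ns1 _).
have sw : iX (v (s n)).1 @[n --> \oo] --> w.
  exact: (cvg_comp _ _ (cvg_subseq_oo ns2) s1w).
(* With the whole space as closed convex set, the fibre lemma says that [w] lies in the image of
   [iX]; its preimage is the candidate weak limit. *)
have [x _ xw] : exists2 x, [set: X] x & iX x = w.
  exact: (hilbert_bounded_fiber P1_hilbert P1_embedding.2 closedT _ _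
    (fun k => vM1 (s k)) sw).
have sx : weak_cvg (fun n => (v (s n)).1) x.
  apply: (hilbert_bounded_weak_cvg P1_hilbert P1_embedding
    (fun k => vM1 (s k))); rewrite xw; exact: sw.
have Axy : A (x, y).
  by apply: (P4 (v \o s)) => [k||]; [exact: Av|exact: sx|exact: s2y].
(* Membership in [A] carries the strong convergence in [W] over from [iX] to [iY], as (P7)
   requires. *)
have sj : j (v (s n)).2 @[n --> \oo] --> j y.
  apply: P7; rewrite -[iY y]Axy /= xw.
  by under eq_cvg do rewrite -[iY _]Av.
suff xy_le : ((j y)%:E + psi gamma y + (eta x)%:E <= (inf S)%:E)%E.
  exists (x, y) => // u Au; have [fu|fu] := pselect (psi gamma u.2 < +oo)%E.
    rewrite [leRHS]gE //; apply: le_trans xy_le _.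
    by rewrite lee_fin; apply: ge_inf; [exact: S_inf.2|exists u].
  by rewrite [leRHS]infE ?leey.
rewrite leNgt; apply/negP => lt_xy.
(* A real [b] below [psi gamma y] treats finite and infinite values together. Out of the margin
   [4 * d], the errors in [j], in [eta] and in the approximation of [inf S] use at most [d] each,
   which gives the contradiction. *)
have [b [d [d0 by_ bd]]] : exists b d, [/\ 0 < d, (b%:E < psi gamma y)%E &
    inf S + 4 * d <= j y + b + eta x].
  have := P5_range _ y gamma0; move: lt_xy.
  case: (psi gamma y) => [r| |] //.
    (* The excess over [inf S] is [5 * d]; lowering [r] to [b = r - d] leaves [4 * d]. *)
    rewrite -!EFinD lte_fin => lt_r _; pose d := (j y + r + eta x - inf S) / 5.
    have d0 : 0 < d by rewrite divr_gt0 // subr_gt0.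
    exists (r - d), d; split=> //; first by rewrite lte_fin ltrBlDr ltrDl.
    by rewrite /d; lra.
  move=> _ _; exists (inf S + 4 - j y - eta x), 1; split=> //.
    exact: ltry.
  by lra.
have near_psi := lt_limn_einf (lt_le_trans by_ (P5 _ gamma0 _ _ s2y)).
have near_eta : \forall n \near \oo, eta x - d < eta (v (s n)).1.
  have [|V Vx VP] := P6 x (eta x - d); first by rewrite lte_fin ltrBlDr ltrDl.
  (* (P6) provides a neighbourhood in [weak_space X], so weak convergence is read as convergence in
     that topology. *)
  have /(_ V Vx) : (fun n => (v (s n)).1) @ \oo --> (x : weak_space X).
    exact/weak_cvgE.
  by move=> [N _ NV]; exists N => // n /NV /VP; rewrite lte_fin.
have /cvgrPdist_lt /(_ _ d0) near_j := sj.
have near_d := near_infty_natSinv_lt (PosNum d0).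
have [n [[[pn en] jn] dn]] :=
  filter_ex (filterI (filterI (filterI near_psi near_eta) near_j) near_d).
have : g (v (s n)) < inf S + d.
  apply: lt_trans (gv (s n)) _; rewrite ltrD2l; apply: le_lt_trans dn.
  by rewrite lef_pV2 ?posrE ?ltr0n // ler_nat ltnS.
move: pn; rewrite /= -(@fineK _ (psi gamma (v (s n)).2)) ?fin_numElt ?P5_range //=.
  rewrite lte_fin; move: en jn; rewrite /g /= ltr_norml => en /andP[jn1 jn2] *.
  by lra.
Qed.
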